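(* Let $n\in\mathbb N$ and let $A$ be an $n\times n$ complex matrix all of whose eigenvalues have positive real parts. Let $m,k\in\mathbb Z_+$ with $k\ge m$, and let $t_0>E_k(0)$. Let $\mu>0$, $p\in\mathscr P_m(k,-\mu,\mathbb C^n)$, and let $g\in C([t_0,\infty),\mathbb C^n)$ satisfy $$|g(t)|=\mathcal O(L_m(t)^{-\alpha})\quad\text{for some }\alpha>\mu.$$ Suppose $y\in C([t_0,\infty),\mathbb C^n)$ is a solution of $$y'=-Ay+p(\widehat{\mathcal L}_k(t))+g(t)\quad\text{on }(t_0,\infty).$$ Then there exists $\delta>0$ such that $$|y(t)-(\mathcal Z_Ap)(\widehat{\mathcal L}_k(t))|=\mathcal O(L_m(t)^{-\mu-\delta}).$$
   Context: $\mathbb Z_+=\{0,1,2,\dots\}$; $|\cdot|$ is the Euclidean norm; $u(t)=\mathcal O(h(t))$ means that there are $T,C>0$ with $|u(t)|\le Ch(t)$ for all $t\ge T$. Iterated functions: $E_0(t)=t$, $E_{m+1}(t)=e^{E_m(t)}$; $L_{-1}(t)=e^t$, $L_0(t)=t$, $L_{m+1}(t)=\ln L_m(t)$ for $m\in\mathbb Z_+$, $t>E_m(0)$. For $k\in\mathbb Z_+$, $\widehat{\mathcal L}_k(t)=(L_{-1}(t),L_0(t),L_1(t),\ldots,L_k(t))=(e^t,t,\ln t,\ldots,L_k(t))$, which lies in $(0,\infty)^{k+2}$ for $t>E_k(0)$. For $t>0$, $c\in\mathbb C$, $t^c=\exp(c\ln t)$. For $z=(z_{-1},z_0,\ldots,z_k)\in(0,\infty)^{k+2}$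 and $\alpha=(\alpha_{-1},\ldots,\alpha_k)\in\mathbb C^{k+2}$, $z^\alpha=\prod_{j=-1}^kz_j^{\alpha_j}$. For integers $k\ge m\ge-1$ and $\mu\in\mathbb R$, $\mathcal E(m,k,\mu)$ is the set of $\alpha\in\mathbb C^{k+2}$ with $\operatorname{Re}\alpha_j=0$ for $-1\le j<m$ and $\operatorname{Re}\alpha_m=\mu$; $\mathscr P_m(k,\mu,\mathbb C^n)$ is the set of functions $p(z)=\sum_{\alpha\in S}z^\alpha\xi_\alpha$, $z\in(0,\infty)^{k+2}$, with $S$ a finite subset of $\mathcal E(m,k,\mu)$ and $\xi_\alpha\in\mathbb C^n$. For such $p$ with $\operatorname{Re}\alpha_{-1}=0$ for all $\alpha\in S$ (in particular for $p\in\mathscr P_m(k,\mu,\mathbb C^n)$ with $m\ge0$), $(\mathcal Z_Ap)(z)=\sum_{\alpha\in S}z^\alpha(A+\alpha_{-1}I_n)^{-1}\xi_\alpha$. *)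

(* Defs.v *)
From HB Require Import structures.
From mathcomp Require Export all_boot all_order all_algebra.
From mathcomp Require Export finmap.
From mathcomp Require Export all_classical all_reals all_analysis.
From mathcomp Require Export complex.
From mathcomp Require Import ring.
Export Order.TTheory GRing.Theory Num.Theory.
Export numFieldNormedType.Exports.

Set Implicit Arguments.
Unset Strict Implicit.
Unset Printing Implicit Defensive.

Local Open Scope classical_set_scope.
Local Open Scope ring_scope.

Section Definitions.
Variable R : realType.
Local Notation C := R[i].

Definition enorm (n : nat) (v : 'cV[C]_n) : R :=
  Num.sqrt (\sum_(i < n) (complex.Re (v i ord0) ^+ 2 + complex.Im (v i ord0) ^+ 2)).

Definition isO (u h : R -> R) : Prop :=
  exists T K : R, [/\ 0 < T, 0 < K &
    forall t : R, T <= t -> `|u t| <= K * h t].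

Definition Eiter (m : nat) (t : R) : R := iter m (@expR R) t.

(* Only the index -1 is meaningful among the negative ones.  As ln is total
   (0 on nonpositive arguments), Liter m.+1 t is the iterated logarithm only
   for t > Eiter m 0. *)
Definition Liter (m : int) (t : R) : R :=
  match m with
  | Posz m' => iter m' (@ln R) t
  | Negz _ => expR t
  end.

(* Vectors z = (z_{-1}, z_0, ..., z_k) are stored as rows of length k + 2; the
   position j holds the coordinate of index j - 1. *)
Definition cidx (k : nat) (j : 'I_k.+2) : int := j%:Z - 1.

Definition Lhat (k : nat) (t : R) : 'rV[R]_k.+2 :=
  \row_(j < k.+2) Liter (cidx j) t.

Definition cexp (c : C) : C :=
  Complex (expR (complex.Re c) * cos (complex.Im c)) (expR (complex.Re c) * sin (complex.Im c)).

Definition cpow (t : R) (c : C) : C := cexp (c * real_complex R (ln t)).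

Definition mpow (k : nat) (z : 'rV[R]_k.+2) (a : 'rV[C]_k.+2) : C :=
  \prod_(j < k.+2) cpow (z ord0 j) (a ord0 j).

Definition posorthant (k : nat) : set 'rV[R]_k.+2 :=
  [set z | forall j, 0 < z ord0 j].

Definition Eset (m : int) (k : nat) (mu : R) : set 'rV[C]_k.+2 :=
  [set a | (forall j, cidx j < m -> complex.Re (a ord0 j) = 0) /\
           (forall j, cidx j = m -> complex.Re (a ord0 j) = mu)].

Definition power_sum (k n : nat) (S : {fset 'rV[C]_k.+2})
    (xi : 'rV[C]_k.+2 -> 'cV[C]_n) (z : 'rV[R]_k.+2) : 'cV[C]_n :=
  \sum_(a <- S) mpow z a *: xi a.

(* Functions on (0, oo)^(k+2) are total functions whose values are constrained
   on the positive orthant only. *)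
Definition represents (k n : nat) (S : {fset 'rV[C]_k.+2})
    (xi : 'rV[C]_k.+2 -> 'cV[C]_n) (p : 'rV[R]_k.+2 -> 'cV[C]_n) : Prop :=
  forall z, posorthant z -> p z = power_sum S xi z.

Definition Pclass (m : int) (k : nat) (mu : R) (n : nat) :
    set ('rV[R]_k.+2 -> 'cV[C]_n) :=
  [set p | exists (S : {fset 'rV[C]_k.+2}) (xi : 'rV[C]_k.+2 -> 'cV[C]_n),
     (forall a, a \in S -> @Eset m k mu a) /\ represents S xi p].

Definition ZA_sum (k n : nat) (A : 'M[C]_n) (S : {fset 'rV[C]_k.+2})
    (xi : 'rV[C]_k.+2 -> 'cV[C]_n) : 'rV[R]_k.+2 -> 'cV[C]_n :=
  power_sum S (fun a => invmx (A + (a ord0 ord0)%:M) *m xi a).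

(* The operator acts on functions p, by choosing a representation of p whose
   exponents satisfy Re alpha_{-1} = 0; ZAE below shows that the choice is
   immaterial.  ZA A p = 0 when p has no such representation. *)
Definition ZA (k n : nat) (A : 'M[C]_n) (p : 'rV[R]_k.+2 -> 'cV[C]_n) :
    'rV[R]_k.+2 -> 'cV[C]_n :=
  xget (fun=> 0)
    [set q | exists (S : {fset 'rV[C]_k.+2}) (xi : 'rV[C]_k.+2 -> 'cV[C]_n),
       [/\ forall a, a \in S -> complex.Re (a ord0 ord0) = 0,
           represents S xi p & q = ZA_sum A S xi]].

(* Continuity and derivatives of C^n-valued functions of a real variable are
   taken coordinatewise, on real and imaginary parts. *)
Definition vcontinuous_on (n : nat) (D : set R) (f : R -> 'cV[C]_n) : Prop :=
  forall i : 'I_n,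
    {within D, continuous (fun s : R => complex.Re (f s i ord0) : R)} /\
    {within D, continuous (fun s : R => complex.Im (f s i ord0) : R)}.

Definition vis_derive (n : nat) (f : R -> 'cV[C]_n) (t : R) (df : 'cV[C]_n) :
    Prop :=
  forall i : 'I_n,
    is_derive t 1 (fun s : R => complex.Re (f s i ord0) : R) (complex.Re (df i ord0)) /\
    is_derive t 1 (fun s : R => complex.Im (f s i ord0) : R) (complex.Im (df i ord0)).

End Definitions.

Section WellDefined.
Variable R : realType.
Local Notation C := R[i].

Lemma cexpD (c d : C) : cexp (c + d) = cexp c * cexp d.
Proof.
case: c d => [a b] [c d]; rewrite /cexp /= expRD cosD sinD.
by apply/eqP; rewrite eq_complex /=; apply/andP; split; apply/eqP; ring.
Qed.

Lemma cexp0 : cexp (0 : C) = 1.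
Proof. by rewrite /cexp /= expR0 cos0 sin0 mulr1 mulr0. Qed.

Lemma cexp_neq0 (c : C) : cexp c != 0.
Proof.
apply/eqP => h; have := cexpD c (- c); rewrite subrr cexp0 h mul0r.
by move/eqP; rewrite oner_eq0.
Qed.

Lemma cexp_sep (c d : C) :
  (forall s : R, cexp (c * s%:C%C) = cexp (d * s%:C%C)) -> c = d.
Proof.
move=> h; apply/eqP; rewrite -subr_eq0; apply/eqP.
have {h} h s : cexp ((c - d) * s%:C%C) = 1.
  apply: (mulIf (cexp_neq0 (d * s%:C%C))).
  by rewrite -cexpD mul1r -h mulrBl subrK.
case: (c - d) h => a b h.
have {}h s : expR (a * s) * cos (b * s) = 1.
  have := congr1 (@complex.Re R) (h s).
  by rewrite /cexp /= !mulr0 subr0 add0r.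
have b0 : b = 0.
  apply/eqP/negPn/negP => bn0; have := h (pi / b).
  rewrite [b * _]mulrC divfK // cospi => /eqP.
  have := expR_gt0 (a * (pi / b)) => e0.
  by rewrite mulrN1 eq_sym -addr_eq0 gt_eqF // addr_gt0.
have := h 1; rewrite b0 mul0r cos0 !mulr1 -[RHS]expR0 => /expR_inj ->.
by [].
Qed.

Definition chi (N : nat) (a : 'rV[C]_N) (x : 'rV[R]_N) : C :=
  cexp (\sum_(j < N) a ord0 j * (x ord0 j)%:C%C).

Lemma chiD N (a : 'rV[C]_N) x y : chi a (x + y) = chi a x * chi a y.
Proof.
rewrite /chi -cexpD -big_split /=; congr cexp; apply: eq_bigr => j _.
by rewrite mxE rmorphD mulrDr.
Qed.

Lemma chi_sep N (a b : 'rV[C]_N) : (forall x, chi a x = chi b x) -> a = b.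
Proof.
move=> h; apply/rowP => j; apply: cexp_sep => s.
have e (c : 'rV[C]_N) : chi c (s *: delta_mx ord0 j) = cexp (c ord0 j * s%:C%C).
  rewrite /chi (bigD1 j) //= big1 ?addr0 => [|i /negPf ij].
    by rewrite !mxE !eqxx mulr1.
  by rewrite !mxE ij andbF mulr0 mulr0.
by rewrite -!e h.
Qed.

Lemma chi_indep N (S : seq 'rV[C]_N) (c : 'rV[C]_N -> C) : uniq S ->
  (forall x, \sum_(a <- S) chi a x * c a = 0) -> forall a, a \in S -> c a = 0.
Proof.
elim: S c => // b S IH c /= /andP[bS uS] h.
have cS a : a \in S -> c a = 0.
  move=> aS; apply/eqP/negPn/negP => ca0.
  suff ab : a = b by rewrite -ab aS in bS.
  apply: chi_sep => y; apply/eqP; rewrite -subr_eq0.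
  suff /eqP : (chi a y - chi b y) * c a = 0.
    by rewrite mulf_eq0 (negPf ca0) orbF.
  apply: (IH (fun a => (chi a y - chi b y) * c a)) => // x.
  have e1 := h (x + y); have e2 := h x; rewrite !big_cons in e1 e2.
  have : (chi b (x + y) * c b + \sum_(j <- S) chi j (x + y) * c j)
       - chi b y * (chi b x * c b + \sum_(j <- S) chi j x * c j) = 0.
    by rewrite e1 e2 mulr0 subr0.
  rewrite mulrDr opprD addrACA chiD.
  rewrite (_ : chi b x * chi b y * c b - chi b y * (chi b x * c b) = 0); last first.
    ring.
  rewrite add0r mulr_sumr -sumrB => e0; rewrite -[RHS]e0; apply: eq_bigr => j _.
  rewrite chiD; ring.
move=> a; rewrite inE => /predU1P[->|]; last exact: cS.
have := h 0; rewrite big_cons big_seq big1 ?addr0 => [|j /cS ->]; last exact: mulr0.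
by move/eqP; rewrite mulf_eq0 (negPf (cexp_neq0 _)) => /eqP.
Qed.

Lemma mpow_chi k (z : 'rV[R]_k.+2) a :
  mpow z a = chi a (\row_j ln (z ord0 j)).
Proof.
rewrite /mpow /chi (big_morph (@cexp R) (@cexpD) cexp0); apply: eq_bigr => j _.
by rewrite mxE.
Qed.

Definition cut k n (S : {fset 'rV[C]_k.+2}) (xi : 'rV[C]_k.+2 -> 'cV[C]_n) a :=
  if a \in S then xi a else 0.

Lemma power_sum_cut k n (S T : {fset 'rV[C]_k.+2}) (xi : _ -> 'cV[C]_n) z :
  (S `<=` T)%fset -> power_sum S xi z = power_sum T (cut S xi) z.
Proof.
move=> ST; rewrite /power_sum.
transitivity (\sum_(a <- S) mpow z a *: cut S xi a).
  by rewrite !big_seq; apply: eq_bigr => a aS; rewrite /cut aS.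
apply: (big_fset_incl _ ST) => a _ aS.
by rewrite /cut (negPf aS) scaler0.
Qed.

Lemma represents_uniq k n (S T : {fset 'rV[C]_k.+2})
    (xi eta : 'rV[C]_k.+2 -> 'cV[C]_n) (p : 'rV[R]_k.+2 -> 'cV[C]_n) :
  represents S xi p -> represents T eta p ->
  forall a, a \in (S `|` T)%fset -> cut S xi a = cut T eta a.
Proof.
move=> hS hT a aU; apply/colP => i; apply/eqP; rewrite -subr_eq0; apply/eqP.
apply: (chi_indep (c := fun a => cut S xi a i ord0 - cut T eta a i ord0)
  (fset_uniq _) _ aU) => x.
pose z : 'rV[R]_k.+2 := \row_j expR (x ord0 j).
have zx : (\row_j ln (z ord0 j)) = x by apply/rowP => j; rewrite !mxE expRK.
have z0 : posorthant z by move=> j; rewrite mxE expR_gt0.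
have := hS z z0; rewrite (hT z z0).
rewrite (power_sum_cut _ _ (fsubsetUl S T)) (power_sum_cut _ _ (fsubsetUr S T)).
move=> /(congr1 (fun v : 'cV_n => v i ord0)); rewrite !summxE => /eqP.
rewrite eq_sym -subr_eq0 -sumrB => /eqP e0; rewrite -[RHS]e0; apply: eq_bigr => b _.
by rewrite !mxE mpow_chi zx mulrBr.
Qed.

Lemma ZA_sum_uniq k n (A : 'M[C]_n) (S T : {fset 'rV[C]_k.+2})
    (xi eta : 'rV[C]_k.+2 -> 'cV[C]_n) (p : 'rV[R]_k.+2 -> 'cV[C]_n) :
  represents S xi p -> represents T eta p -> ZA_sum A S xi = ZA_sum A T eta.
Proof.
move=> hS hT; apply/funext => z; rewrite /ZA_sum.
rewrite (power_sum_cut _ _ (fsubsetUl S T)) (power_sum_cut _ _ (fsubsetUr S T)).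
rewrite /power_sum !big_seq; apply: eq_bigr => a aU; congr (_ *: _).
have cutM (V : {fset 'rV[C]_k.+2}) (f : 'rV[C]_k.+2 -> 'cV[C]_n) :
    cut V (fun a => invmx (A + (a ord0 ord0)%:M) *m f a) a
    = invmx (A + (a ord0 ord0)%:M) *m cut V f a.
  by rewrite /cut; case: ifP => // _; rewrite mulmx0.
by rewrite !cutM (represents_uniq hS hT aU).
Qed.

Lemma ZAE k n (A : 'M[C]_n) (S : {fset 'rV[C]_k.+2})
    (xi : 'rV[C]_k.+2 -> 'cV[C]_n) (p : 'rV[R]_k.+2 -> 'cV[C]_n) :
  (forall a, a \in S -> complex.Re (a ord0 ord0) = 0) -> represents S xi p ->
  ZA A p = ZA_sum A S xi.
Proof.
move=> S0 hS; rewrite /ZA.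
case: xgetP => [q _ [T [eta [_ hT ->]]]|/(_ (ZA_sum A S xi)) []].
  exact: ZA_sum_uniq hT hS.
by exists S, xi.
Qed.

End WellDefined.

(* Main.v *)
Require Import Defs.
From mathcomp Require Import ring lra spectral mxred.
Local Open Scope classical_set_scope.
Local Open Scope ring_scope.
Import Normc.

(** Write L_i for the i-th iterated logarithm.  Along the curve [Lhat k t] the
    monomial z^a is [cexp (\sum_i a_i L_i(t))], with a_i in position i, so its
    logarithmic derivative is a_0 plus terms of size O(1/t).  Since
    A (A + a_0)^-1 = 1 - a_0 (A + a_0)^-1, the function q = ZA A p (Lhat k t)
    solves q' = - A q + p + r with r = O(L_m^(-mu - delta)) for every delta < 1.
    Hence w = y - q solves w' = - A w + O(h) with h = L_m^(-mu - delta), and it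
    remains to see that w = O(h).  Schur triangularisation reduces this to scalar
    equations v' = - l v + O(h) with Re l > 0, solved row by row.  For these,
    u = |v|^2 and H = h^2 satisfy u' <= - c u + K H with c = Re l, while
    H' = o(H), so that exp(c t) (u - M H) is nonincreasing for M large. *)

(** * Derivatives and growth bounds of complex-valued functions of a real variable *)

Section ComplexValued.
Local Set Implicit Arguments.
Local Unset Strict Implicit.
Variable R : realType.
Local Notation C := R[i].
Implicit Types (f g : R -> C) (h : R -> R) (t : R).

(** One coordinate of [vis_derive], so that the two notions agree by conversion. *)
Definition cderive f t (df : C) : Prop :=
  is_derive t 1 (fun s => complex.Re (f s)) (complex.Re df) /\
  is_derive t 1 (fun s => complex.Im (f s)) (complex.Im df).

Lemma cderive_cst (c : C) t : cderive (fun=> c) t 0.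
Proof. by split; exact: is_derive_cst. Qed.

Lemma cderiveD f g t df dg :
  cderive f t df -> cderive g t dg -> cderive (fun s => f s + g s) t (df + dg).
Proof.
move=> [f1 f2] [g1 g2]; split; rewrite raddfD; under eq_fun do rewrite raddfD;
  exact: is_deriveD.
Qed.

Lemma cderiveMl (c : C) f t df :
  cderive f t df -> cderive (fun s => c * f s) t (c * df).
Proof.
move=> [f1 f2]; split.
  rewrite (_ : (fun s => _) = (complex.Re c \*: (fun s => complex.Re (f s)))
    - (complex.Im c \*: (fun s => complex.Im (f s)))); last first.
    by apply/funext => s; rewrite !fctE /=; case: c (f s) => a b [].
  apply: is_derive_eq.
  by case: c df {f1 f2} => a b [].
rewrite (_ : (fun s => _) = (complex.Re c \*: (fun s => complex.Im (f s)))
    + (complex.Im c \*: (fun s => complex.Re (f s)))); last first.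
  by apply/funext => s; rewrite !fctE /=; case: c (f s) => a b [].
apply: is_derive_eq.
by case: c df {f1 f2} => a b [].
Qed.

Lemma cderive_sum (I : Type) (r : seq I) (P : pred I) (f : I -> R -> C) t df :
  (forall i, P i -> cderive (f i) t (df i)) ->
  cderive (fun s => \sum_(i <- r | P i) f i s) t (\sum_(i <- r | P i) df i).
Proof.
move=> fP; elim: r => [|i r IH].
  by rewrite big_nil; under eq_fun do rewrite big_nil; exact: cderive_cst.
rewrite big_cons; under eq_fun do rewrite big_cons.
by case: ifPn => // Pi; apply: cderiveD => //; exact: fP.
Qed.

Lemma cderive_real h t dh :
  is_derive t 1 h dh -> cderive (fun s => (h s)%:C%C) t dh%:C%C.
Proof. by move=> dht; split => //=; exact: is_derive_cst. Qed.

Lemma cderive_cexp f t df :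
  cderive f t df -> cderive (fun s => cexp (f s)) t (cexp (f t) * df).
Proof.
move=> [f1 f2]; split => /=.
- apply: (@is_derive_eq _ _ _ ((expR \o (fun s => complex.Re (f s))) *
    (cos \o (fun s => complex.Im (f s))))).
  by rewrite /GRing.scale/=; case: df {f1 f2} => a b /=; ring.
- apply: (@is_derive_eq _ _ _ ((expR \o (fun s => complex.Re (f s))) *
    (sin \o (fun s => complex.Im (f s))))).
  by rewrite /GRing.scale/=; case: df {f1 f2} => a b /=; ring.
Qed.

Lemma normc_ge0 (c : C) : 0 <= normc c.
Proof. by case: c => a b; rewrite sqrtr_ge0. Qed.

Lemma sqr_normcE (c : C) :
  normc c ^+ 2 = complex.Re c ^+ 2 + complex.Im c ^+ 2.
Proof. by case: c => a b; rewrite /= sqr_sqrtr // addr_ge0 ?sqr_ge0. Qed.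

Lemma normc_cexp (c : C) : normc (cexp c) = expR (complex.Re c).
Proof.
apply/eqP; rewrite -(eqrXn2 (n := 2)) ?normc_ge0 ?expR_ge0 //.
by rewrite sqr_normcE /= !exprMn -mulrDr cos2Dsin2 mulr1.
Qed.

Lemma normc_real (r : R) : normc r%:C%C = `|r|.
Proof. by rewrite /= expr0n addr0 sqrtr_sqr. Qed.

(** No sign is imposed on [K]; [isO_enorm] makes the constant positive at the end. *)
Definition cbigO h f : Prop :=
  exists K : R, \forall t \near +oo, normc (f t) <= K * h t.

Lemma cbigO0 h : cbigO h (fun=> 0).
Proof. by exists 0; near=> t; rewrite normc0 mul0r. Unshelve. all: end_near. Qed.

Lemma cbigOD h f g : cbigO h f -> cbigO h g -> cbigO h (fun t => f t + g t).
Proof.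
move=> [K fK] [L gL]; exists (K + L); near=> t.
rewrite mulrDl (le_trans (le_normcD _ _)) // lerD //; near: t; assumption.
Unshelve. all: end_near. Qed.

Lemma cbigOMl h (c : C) f : cbigO h f -> cbigO h (fun t => c * f t).
Proof.
move=> [K fK]; exists (normc c * K); near=> t.
rewrite normcM -mulrA ler_wpM2l ?normc_ge0 //; near: t; assumption.
Unshelve. all: end_near. Qed.

Lemma cbigON h f : cbigO h f -> cbigO h (fun t => - f t).
Proof.
by move=> /(cbigOMl (-1)); under [X in _ -> cbigO h X]eq_fun do rewrite -mulN1r.
Qed.

Lemma cbigO_sum h (I : Type) (r : seq I) (P : pred I) (f : I -> R -> C) :
  (forall i, P i -> cbigO h (f i)) ->
  cbigO h (fun t => \sum_(i <- r | P i) f i t).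
Proof.
move=> fP; elim: r => [|i r IH].
  by under [X in cbigO _ X]eq_fun do rewrite big_nil; exact: cbigO0.
under [X in cbigO _ X]eq_fun do rewrite big_cons.
by case: (boolP (P i)) => Pi //; apply: cbigOD => //; exact: fP.
Qed.

(** Serves sums over the exponents of a power sum, whose bounds are known only for members of the
    index set. *)
Lemma cbigO_sum_seq h (I : eqType) (r : seq I) (f : I -> R -> C) :
  (forall i, i \in r -> cbigO h (f i)) ->
  cbigO h (fun t => \sum_(i <- r) f i t).
Proof.
move=> fr; suff -> : (fun t => \sum_(i <- r) f i t)
  = (fun t => \sum_(i <- r | i \in r) f i t) by exact: cbigO_sum.
by apply/funext => t; rewrite big_seq.
Qed.

End ComplexValued.

(** * Stable linear equations with slowly varying forcing *)

Section Stability.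
Local Set Implicit Arguments.
Local Unset Strict Implicit.
Variable R : realType.
Local Notation C := R[i].
Implicit Types (h dh u du : R -> R) (t : R).

(** Half of the damping rate [c] absorbs the decay of [h], the other half the forcing: if K <= M
    c/2, then (u - M h)' <= - c (u - M h). *)
Lemma gronwall_bound (c K T : R) u du h dh : 0 < c -> 0 <= K ->
  (forall t, T <= t -> [/\ is_derive t 1 u (du t), is_derive t 1 h (dh t),
     0 < h t, - (c / 2) * h t <= dh t & du t <= - c * u t + K * h t]) ->
  exists2 M : R, 0 <= M & forall t, T <= t -> u t <= M * h t.
Proof.
move=> c0 K0 H.
have [_ _ hT _ _] := H T (lexx T).
(* The first summand gives K <= M c/2, the second makes u - M h nonpositive at [T]. *)
pose M := 2 * K / c + `|u T| / h T.
have M1 : 0 <= 2 * K / c by rewrite divr_ge0 ?mulr_ge0 // ltW.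
have M2 : 0 <= `|u T| / h T by rewrite divr_ge0 // ltW.
have M0 : 0 <= M by rewrite addr_ge0.
have KM : K <= M * (c / 2).
  rewrite /M mulrDl (_ : 2 * K / c * (c / 2) = K); last by field; rewrite gt_eqF.
  by rewrite lerDl mulr_ge0 // divr_ge0 // ltW.
exists M => // t Tt.
pose phi := (expR \o ( *%R c)) * (u - (M \*: h)).
have dphi s : T <= s -> is_derive s 1 phi
    (expR (c * s) * (c * (u s - M * h s) + (du s - M * dh s))).
  move=> Ts; have [us hs _ _ _] := H s Ts.
  have es : is_derive s 1 (expR \o ( *%R c)) (expR (c * s) * c).
    apply: is_derive1_comp; apply: (@is_derive_eq _ _ _ (c \*: id)).
    by rewrite /GRing.scale/= mulr1.
  apply: is_derive_eq.
  by rewrite !fctE /= /GRing.scale/=; ring.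
have : phi t <= phi T.
  apply: (@ler0_derive1_nincry _ phi T) => // [x|x|].
  - by rewrite in_itv/= andbT => /ltW /dphi [].
  - rewrite in_itv/= andbT => /ltW Tx; have dx := dphi x Tx.
    rewrite derive1E derive_val.
    have [_ _ hx dhx dux] := H x Tx.
    rewrite pmulr_rle0 ?expR_gt0 //.
    have : M * (- (c / 2) * h x) <= M * dh x by rewrite ler_wpM2l.
    have : K * h x <= M * (c / 2) * h x by rewrite ler_wpM2r // ltW.
    lra.
  - apply: derivable_within_continuous => x; rewrite in_itv/= andbT => Tx.
    by have [] := dphi x Tx.
have phiT : phi T <= 0.
  rewrite /phi !fctE /= /GRing.scale /= pmulr_rle0 ?expR_gt0 // subr_le0 /M mulrDl.
  rewrite divfK ?gt_eqF // (le_trans (ler_norm _)) // lerDr mulr_ge0 // ltW //.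
move=> /le_trans /(_ phiT).
by rewrite /phi !fctE /= /GRing.scale /= pmulr_rle0 ?expR_gt0 // subr_le0.
Qed.

(** Such an [h] decays more slowly than every e^(-ct) with c > 0, so the damping of a stable
    equation always outpaces it. *)
Definition slow h : Prop := exists2 dh : R -> R,
  \forall t \near +oo, 0 < h t /\ is_derive t 1 h (dh t) &
  forall e : R, 0 < e -> \forall t \near +oo, `|dh t| <= e * h t.

(** Im l drops out of (|v|^2)', which is - 2c |v|^2 plus twice the real inner product of v and f. By
    Young's inequality the latter is at most c |v|^2 + |f|^2 / c, so [gronwall_bound] applies to
    |v|^2 and h^2. *)
Lemma cbigO_scalar_ode (l : C) (v f : R -> C) h : 0 < complex.Re l -> slow h ->
  (\forall t \near +oo, cderive v t (- (l * v t) + f t)) ->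
  cbigO h f -> cbigO h v.
Proof.
move=> l0 [dh dhP dhe] dv [K fK].
set c := complex.Re l in l0 *.
(* Since (h^2)' = 2 h h', the bound h' >= - (c/4) h gives the rate c/2 that [gronwall_bound] asks of
   h^2. *)
have c4 : 0 < c / 4 by lra.
have H := filterI (filterI dhP (dhe _ c4)) (filterI dv fK).
have [T [_ {}H]] := H.
pose u t := normc (v t) ^+ 2.
pose F t := - (l * v t) + f t.
pose du t := 2 * (complex.Re (v t) * complex.Re (F t)
  + complex.Im (v t) * complex.Im (F t)).
(* The facts in [H] hold for t > T strictly; starting at T + 1 gives a closed half-line. *)
have [||M M0 MP] := @gronwall_bound c (K ^+ 2 / c) (T + 1) u du
  (fun t => h t ^+ 2) (fun t => 2 * h t * dh t) l0.
- by rewrite divr_ge0 ?sqr_ge0 // ltW.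
- move=> t Tt.
  have [|[[ht dht] dhle] [[dv1 dv2] ft]] := H t.
    by rewrite (lt_le_trans _ Tt) // ltrDl.
  split.
  + rewrite /u; under eq_fun do rewrite sqr_normcE.
    apply: (is_derive_eq (is_deriveD (is_deriveX 2 dv1) (is_deriveX 2 dv2))).
    by rewrite /GRing.scale /= /du -/(F t); ring.
  + apply: (@is_derive_eq _ _ _ (h ^+ 2)).
    by rewrite /GRing.scale /=; ring.
  + by rewrite exprn_gt0.
  + have : - (c / 4 * h t) <= dh t by rewrite lerNl (le_trans _ dhle) // -normrN ler_norm.
    rewrite (_ : - (c / 2) * _ = 2 * h t * - (c / 4 * h t)); last by field.
    by rewrite ler_pM2l // mulr_gt0.
  + have f2 : complex.Re (f t) ^+ 2 + complex.Im (f t) ^+ 2 <= K ^+ 2 * h t ^+ 2.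
      rewrite -sqr_normcE -exprMn ler_sqr ?nnegrE ?normc_ge0 //.
      exact: le_trans (normc_ge0 _) ft.
    rewrite /du /u sqr_normcE /F.
    have -> : K ^+ 2 / c * h t ^+ 2 = (K ^+ 2 * h t ^+ 2) / c by field; rewrite gt_eqF.
    have {}f2 : (complex.Re (f t) ^+ 2 + complex.Im (f t) ^+ 2) / c <= (K ^+ 2 * h t ^+ 2) / c.
      by rewrite ler_pM2r ?invr_gt0.
    apply: le_trans (lerD (lexx _) f2).
    (* the difference is |f - c v|^2 / c *)
    rewrite -subr_ge0.
    rewrite (_ : _ - _ = ((complex.Re (f t) - c * complex.Re (v t)) ^+ 2
      + (complex.Im (f t) - c * complex.Im (v t)) ^+ 2) / c).
      by rewrite divr_ge0 ?addr_ge0 ?sqr_ge0 // ltW.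
    move: (v t) (f t) l0; rewrite /c; clear.
    case: l => a b [x y] [x' y'] /= a0.
    by field; rewrite gt_eqF.
exists (Num.sqrt M); near=> t.
have ht : 0 < h t by have [] := near dhP t.
rewrite -ler_sqr ?nnegrE ?normc_ge0 ?mulr_ge0 ?sqrtr_ge0 ?(ltW ht) //.
by rewrite exprMn sqr_sqrtr //; apply: MP.
Unshelve. all: end_near. Qed.

Lemma vis_derive_cderive n (f : R -> 'cV[C]_n) t df :
  vis_derive f t df <-> forall i, cderive (fun s => f s i ord0) t (df i ord0).
Proof. by []. Qed.

Lemma vis_derive_mulmx n (P : 'M[C]_n) (f : R -> 'cV[C]_n) t df :
  vis_derive f t df -> vis_derive (fun s => P *m f s) t (P *m df).
Proof.
move=> /vis_derive_cderive fP; apply/vis_derive_cderive => i.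
rewrite mxE; under eq_fun do rewrite mxE.
by apply: cderive_sum => j _; apply: cderiveMl.
Qed.

Lemma cbigO_mulmx n (P : 'M[C]_n) (f : R -> 'cV[C]_n) h :
  (forall i, cbigO h (fun s => f s i ord0)) ->
  forall i, cbigO h (fun s => (P *m f s) i ord0).
Proof.
move=> fP i; under eq_fun do rewrite mxE.
by apply: cbigO_sum => j _; apply: cbigOMl.
Qed.

Lemma eigenvalue_trig n (T : 'M[C]_n) i : is_trig_mx T -> eigenvalue T (T i i).
Proof.
move=> Ttrig; rewrite eigenvalue_root_char char_poly_trig // (bigD1 i) //=.
by rewrite rootM root_XsubC eqxx.
Qed.

(** After the change of basis v = P w the matrix is lower triangular, so row i couples v_i only to
    the v_j with j < i. These are already O(h) and join the forcing of a scalar equation. *)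
Lemma cbigO_linear_ode n (A : 'M[C]_n) (w f : R -> 'cV[C]_n) h :
  (forall l, eigenvalue A l -> 0 < complex.Re l) -> slow h ->
  (\forall t \near +oo, vis_derive w t (- (A *m w t) + f t)) ->
  (forall i, cbigO h (fun t => f t i ord0)) ->
  forall i, cbigO h (fun t => w t i ord0).
Proof.
(* [Schur] asks for a positive dimension; in dimension 0 there is no coordinate to bound. *)
case: n => [|n] in A w f *; first by move=> ? ? ? ? [].
move=> hA hslow dw fO.
have [P Pu] := Schur A isT.
have Punit := unitarymx_unit Pu.
rewrite /similar_to conjumx //; set T := _ *m invmx P => Ttrig.
have TP : T *m P = P *m A by rewrite /T mulmxKV.
have hT i : 0 < complex.Re (T i i).
  (* Eigenvectors are row vectors: v T = T_ii v gives (v P) A = T_ii (v P), because T P = P A. *)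
  apply: hA; have /eigenvalueP[v vT v0] := eigenvalue_trig i Ttrig.
  apply/eigenvalueP; exists (v *m P).
    by rewrite -mulmxA -TP mulmxA vT scalemxAl.
  apply: contra_neq v0 => vP0.
  by rewrite -(mulmxK Punit v) vP0 mul0mx.
pose v t := P *m w t.
have dv : \forall t \near +oo, vis_derive v t (- (T *m v t) + P *m f t).
  near=> t.
  have -> : - (T *m v t) + P *m f t = P *m (- (A *m w t) + f t).
    by rewrite mulmxDr mulmxN /v !mulmxA TP.
  by apply: vis_derive_mulmx; near: t.
have vO (k : nat) : forall i : 'I_n.+1, (i < k)%N -> cbigO h (fun t => v t i ord0).
  elim: k => // k IH i; rewrite ltnS => ik.
  (* Everything in row i except the diagonal term; the summands with j > i vanish by
     triangularity. *)
  pose r t := - \sum_(j < n.+1 | j != i) T i j * v t j ord0 + (P *m f t) i ord0.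
  apply: (@cbigO_scalar_ode (T i i) _ r) => //.
    near=> t.
    have /vis_derive_cderive/(_ i) : vis_derive v t (- (T *m v t) + P *m f t).
      by near: t.
    congr cderive; rewrite /r mxE [(- (_ *m _)) _ _]mxE [(T *m _) _ _]mxE.
    by rewrite (bigD1 i) //= opprD addrA.
  apply: cbigOD; last exact: cbigO_mulmx.
  apply/cbigON/cbigO_sum => j ji; have [ij|] := ltnP i j.
    have /is_trig_mxP T0 := Ttrig.
    by under eq_fun do rewrite T0 // mul0r; exact: cbigO0.
  rewrite leq_eqVlt val_eqE (negPf ji) /= => lji.
  by apply/cbigOMl/IH/(leq_trans lji).
move=> i; under eq_fun do rewrite -[w _](mulKmx Punit) -/(v _).
by apply: cbigO_mulmx => {}i; exact: (vO n.+1).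
Unshelve. all: end_near. Qed.

End Stability.

(** * Growth and derivatives of iterated logarithms, and monomials along [Lhat] *)

Section IteratedLog.
Local Set Implicit Arguments.
Local Unset Strict Implicit.
Variable R : realType.
Local Notation C := R[i].
Implicit Types (e nu mu : R) (i j k m : nat) (t : R).

(** [Liter] at a nonnegative index, with the index in [nat]. *)
Definition iln i t : R := iter i (@ln R) t.

Arguments iln : simpl never.

Lemma iln_cvgy i : iln i t @[t --> +oo] --> +oo.
Proof.
elim: i => [|i IH]; first exact: cvg_id.
apply/cvgryPge => B; near=> t; rewrite /iln iterS -/(iln i t).
have : expR B <= iln i t by near: t; exact: (cvgry_ge IH).
by move=> eB; rewrite -[B]expRK ler_ln ?posrE ?(lt_le_trans _ eB) ?expR_gt0.
Unshelve. all: end_near. Qed.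

Lemma iln_ge i (B : R) : \forall t \near +oo, B <= iln i t.
Proof. exact: (cvgry_ge (@iln_cvgy i)). Qed.

Lemma iln_gt0 i : \forall t \near +oo, 0 < iln i t.
Proof.
by apply: filterS (iln_ge i 1) => t; apply: lt_le_trans.
Qed.

Lemma iln_gt0_upto N : \forall t \near +oo, forall i, (i < N)%N -> 0 < iln i t.
Proof.
elim: N => [|N IH]; first by near=> t => i; rewrite ltn0.
near=> t => i; rewrite ltnS leq_eqVlt => /predU1P[->|].
  by near: t; exact: iln_gt0.
by move: i; near: t.
Unshelve. all: end_near. Qed.

(** Apply ln y < y to y = (e/2) x; the constant - ln (e/2) is absorbed by the remaining (e/2) x for
    large x. *)
Lemma ln_little e : 0 < e -> \forall x \near +oo, ln x <= e * x.
Proof.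
move=> e0; have e2 : 0 < e / 2 by lra.
near=> x.
have x0 : 0 < x by [].
have xe : - ln (e / 2) / (e / 2) <= x by [].
have : ln (e / 2 * x) < e / 2 * x by rewrite ln_sublinear // mulr_gt0.
rewrite lnM ?posrE // => h1.
move: xe; rewrite ler_pdivrMr // => h2.
by lra.
Unshelve. all: end_near. Qed.

Lemma iln_little e i j : 0 < e -> (i < j)%N ->
  \forall t \near +oo, iln j t <= e * iln i t.
Proof.
move=> e0; elim: j => // j IH; rewrite ltnS leq_eqVlt => /predU1P[->|/IH {}IH].
  exact: (@iln_cvgy j) _ (ln_little e0).
near=> t; apply: (@le_trans _ _ (iln j t)); last by near: t.
by apply/ltW/ln_sublinear; near: t; exact: iln_gt0.
Unshelve. all: end_near. Qed.

Fixpoint diln i t : R :=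
  if i is j.+1 then (iln j t)^-1 * diln j t else 1.

Lemma is_derive_iln i t : (forall j, (j < i)%N -> 0 < iln j t) ->
  is_derive t 1 (iln i) (diln i t).
Proof.
elim: i => [|i IH] i0; first exact: is_derive_id.
apply: (@is_derive1_comp _ (@ln R) (iln i)).
  by apply: is_derive1_ln; exact: i0.
by apply: IH => j ji; apply: i0; exact: leqW.
Qed.

(** L_(i+1)' is the inverse of the product L_0 ... L_i; the factor L_0 gives 1/t and the others are
    eventually at least 1. *)
Lemma diln_le i : \forall t \near +oo, `|diln i.+1 t| <= t^-1.
Proof.
elim: i => [|i IH].
  near=> t; rewrite /= mulr1 ger0_norm // invr_ge0.
  by near: t; exact: nbhs_pinfty_ge.
near=> t; rewrite [diln _ _]/= -/(diln i.+1 t) normrM.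
have i1 : 1 <= iln i.+1 t by near: t; exact: iln_ge.
rewrite (le_trans _ (near IH t _)) // ler_piMl //.
have i0 : 0 < iln i.+1 t := lt_le_trans ltr01 i1.
by rewrite normrV ?unitfE ?gt_eqF // gtr0_norm // invf_le1.
Unshelve. all: end_near. Qed.

(** The function is L_i^(-nu) written as an exponential, and its logarithmic derivative - nu
    L_(i+1)' is O(1/t). The successor matters: with L_0 in its place, e^(-nu t) is not slow for nu
    <> 0. *)
Lemma slow_exp_iln nu i : slow (fun t => expR (- nu * iln i.+1 t)).
Proof.
exists (fun t => expR (- nu * iln i.+1 t) * (- nu * diln i.+1 t)).
  near=> t; split; first exact: expR_gt0.
  have di : is_derive t 1 (iln i.+1) (diln i.+1 t) 
    by apply: is_derive_iln; near: t; exact: iln_gt0_upto.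
  by apply: (@is_derive1_comp _ expR (- nu \*: iln i.+1)).
move=> e e0; near=> t.
rewrite normrM (ger0_norm (expR_ge0 _)) mulrC ler_wpM2r ?expR_ge0 //.
rewrite normrM normrN.
have t0 : 0 < t by [].
apply: (@le_trans _ _ (`|nu| * t^-1)).
  by rewrite ler_wpM2l //; near: t; exact: diln_le.
by rewrite ler_pdivrMr // mulrC -ler_pdivrMr.
Unshelve. all: end_near. Qed.

Lemma powR_iln nu m t : 0 < iln m t -> iln m t `^ nu = expR (nu * iln m.+1 t).
Proof. by move=> h; rewrite /powR gt_eqF. Qed.

Lemma Liter_cidxS k i (lti : (i.+1 < k.+2)%N) t :
  Liter (cidx (Ordinal lti)) t = iln i t.
Proof. by rewrite /cidx [_%:Z](intS i) addrC addKr. Qed.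

(** Position i holds L_(i-1), whose logarithm is L_i; at position 0 this reads ln (e^t) = t. Both
    sides use the same total [ln], so the identity holds for every t. *)
Lemma mpow_Lhat k t (a : 'rV[C]_k.+2) :
  mpow (Lhat k t) a = cexp (\sum_(i < k.+2) a ord0 i * (iln i t)%:C%C).
Proof.
rewrite /mpow (big_morph (@cexp R) (@cexpD R) (cexp0 R)).
apply: eq_bigr => -[[|i] lti] _; rewrite /cpow mxE.
  by rewrite -[Liter _ _]/(expR t) expRK.
by rewrite Liter_cidxS.
Qed.

Lemma posorthant_Lhat k : \forall t \near +oo, posorthant (Lhat k (t : R)).
Proof.
near=> t => -[[|i] lti]; rewrite mxE; first exact: expR_gt0.
rewrite Liter_cidxS; move: i lti; near: t.
by apply: filterS (iln_gt0_upto k.+1) => t h i /h.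
Unshelve. all: end_near. Qed.

(** A finite sum of terms eventually below every multiple of L has the same property: [e] is halved
    at each summand. *)
Lemma near_sum_le (I : Type) (r : seq I) (P : pred I) (f : I -> R -> R)
    (L : R -> R) :
  (\forall t \near +oo, 0 <= L t) ->
  (forall i : I, P i -> forall e, 0 < e -> \forall t \near +oo, f i t <= e * L t) ->
  forall e, 0 < e ->
  \forall t \near +oo, \sum_(i <- r | P i) f i t <= e * L t.
Proof.
move=> L0 fP; elim: r => [|i r IH] e e0.
  near=> t; rewrite big_nil mulr_ge0 ?(ltW e0) //; near: t; exact: L0.
have e2 : 0 < e / 2 by lra.
have {}IH := IH _ e2; case: (boolP (P i)) => Pi.
  have fi := fP i Pi _ e2; near=> t; rewrite big_cons Pi.
  have : f i t <= e / 2 * L t by near: t.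
  have : \sum_(i <- r | P i) f i t <= e / 2 * L t by near: t.
  by lra.
near=> t; rewrite big_cons (negPf Pi).
apply: (@le_trans _ _ (e / 2 * L t)); first by near: t.
by apply: ler_wpM2r; [near: t|lra].
Unshelve. all: end_near. Qed.

(* The exponents of index above m contribute only powers of iterated logarithms
   of L_m, hence cost an arbitrarily small power of L_m. *)
Lemma normc_mpow_Lhat_le m k mu e (a : 'rV[C]_k.+2) : (m <= k)%N -> 0 < e ->
  Eset m%:Z (- mu) a ->
  \forall t \near +oo,
    normc (mpow (Lhat k t) a) <= expR (- (mu - e) * iln m.+1 t).
Proof.
move=> mk e0 [a0 am].
have mk2 : (m.+1 < k.+2)%N by rewrite ltnS.
(* Position m + 1 carries index m, the one whose exponent has real part - mu. *)
pose i0 := Ordinal mk2.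
have cidxS (j : 'I_k.+2) : cidx j = j%:Z - 1 by [].
have Rea (j : 'I_k.+2) : (j < m.+1)%N -> complex.Re (a ord0 j) = 0.
  by move=> jm; apply: a0; rewrite cidxS ltrBlDr -PoszD addn1 ltz_nat.
have Ream : complex.Re (a ord0 i0) = - mu.
  by apply: am; rewrite cidxS /= -addn1 PoszD addrK.
have H := @near_sum_le _ (index_enum 'I_k.+2) (fun j : 'I_k.+2 => j != i0)
  (fun (j : 'I_k.+2) t => complex.Re (a ord0 j) * iln j t) (iln m.+1).
near=> t.
rewrite mpow_Lhat normc_cexp ler_expR.
have -> : complex.Re (\sum_(i < k.+2) a ord0 i * (iln i t)%:C%C) =
    \sum_(i < k.+2) complex.Re (a ord0 i) * iln i t.
  rewrite raddf_sum; apply: eq_bigr => i _.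
  by case: (a ord0 i) => x z /=; rewrite mulr0 subr0.
rewrite (bigD1 i0) //= Ream mulNr.
suff : \sum_(j < k.+2 | j != i0) complex.Re (a ord0 j) * iln j t
   <= e * iln m.+1 t.
  by rewrite -/(iln m.+1 t); lra.
near: t; apply: H => //.
  by apply: filterS (iln_gt0 m.+1) => t /ltW.
(* Positions below m + 1 have purely imaginary exponents and contribute 0 to the sum; above m + 1,
   L_j is o(L_(m+1)). *)
move=> j ji e' e'0; have [jm|] := ltnP j m.+1.
  near=> t; rewrite Rea // mul0r mulr_ge0 ?(ltW e'0) // ltW //.
  by near: t; exact: iln_gt0.
rewrite leq_eqVlt eq_sym => /orP[jm|jm]; first by rewrite -val_eqE jm in ji.
set c := complex.Re _.
(* The added 1 keeps the denominator positive when c = 0. *)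
have c0 : 0 < e' / (`|c| + 1) by rewrite divr_gt0 // ltr_wpDl.
near=> t.
have j0 : 0 < iln j t by near: t; exact: iln_gt0.
have lej : iln j t <= e' / (`|c| + 1) * iln m.+1 t by near: t; exact: iln_little.
apply: (@le_trans _ _ ((`|c| + 1) * iln j t)).
  by rewrite ler_pM2r // (le_trans (ler_norm _)) // lerDl.
apply: (le_trans (ler_wpM2l _ lej)); first by rewrite addr_ge0.
rewrite mulrA mulrCA divff ?mulr1 //.
Unshelve. all: end_near. Qed.

(** Here 1/t = exp(- L_1) and L_(m+1) <= L_1 eventually. A factor 1/t thus gains a full power of
    L_m, whence the restriction to delta < 1. *)
Lemma inv_le_expR_iln m : \forall t \near +oo, t^-1 <= expR (- iln m.+1 t).
Proof.
have mE : \forall t \near +oo, iln m.+1 t <= iln 1 t.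
  case: m => [|m]; first by near=> t.
  by near=> t; rewrite -[leRHS]mul1r; near: t; exact: iln_little.
near=> t.
have t0 : 0 < t by [].
rewrite -[t^-1]lnK ?posrE ?invr_gt0 // ler_expR lnV ?posrE // lerN2.
by near: t.
Unshelve. all: end_near. Qed.

End IteratedLog.

(** * The approximate solution, its residual, and passage to the Euclidean norm *)

Section PowerSums.
Local Set Implicit Arguments.
Local Unset Strict Implicit.
Variable R : realType.
Local Notation C := R[i].
Implicit Types (t mu nu : R).

Lemma cderive_mpow_Lhat k (a : 'rV[C]_k.+2) t :
  (forall j, (j < k.+1)%N -> 0 < iln j t) ->
  cderive (fun s => mpow (Lhat k s) a) t
    (mpow (Lhat k t) a * \sum_(i < k.+2) a ord0 i * (diln i t)%:C%C).
Proof.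
move=> lt0; under eq_fun do rewrite mpow_Lhat.
rewrite mpow_Lhat; apply: cderive_cexp; apply: cderive_sum => i _.
apply/cderiveMl/cderive_real/is_derive_iln => j ji; apply: lt0.
by rewrite (leq_trans ji) // -ltnS.
Qed.

(** If A + c were singular, - c would be an eigenvalue of A with zero real part. *)
Lemma unitmx_addM n (A : 'M[C]_n) (c : C) :
  (forall l, eigenvalue A l -> 0 < complex.Re l) -> complex.Re c = 0 ->
  A + c%:M \in unitmx.
Proof.
move=> hA c0; apply: contraT => Ac.
have /hA : eigenvalue A (- c).
  by rewrite /eigenvalue /eigenspace kermx_eq0 row_free_unit raddfN opprK.
by rewrite raddfN /= c0 oppr0 ltxx.
Qed.

Section ApproximateSolution.
Variables (n k : nat) (A : 'M[C]_n) (S : {fset 'rV[C]_k.+2}).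
Variable xi : 'rV[C]_k.+2 -> 'cV[C]_n.

(** The part of the derivative of [ZA_sum] along the curve that comes from positions i >= 1;
    position 0 contributes exactly a_0, since L_0' = 1. *)
Definition ZA_residual t : 'cV[C]_n :=
  \sum_(a <- S) (mpow (Lhat k t) a *
    \sum_(i < k.+1) a ord0 (lift ord0 i) * (diln i.+1 t)%:C%C) *:
    (invmx (A + (a ord0 ord0)%:M) *m xi a).

(** With eta = (A + a_0)^-1 xi one has - A eta + xi = a_0 eta, which is the position 0 term of the
    logarithmic derivative. *)
Lemma vis_derive_ZA_sum t :
  (forall l, eigenvalue A l -> 0 < complex.Re l) ->
  (forall a, a \in S -> complex.Re (a ord0 ord0) = 0) ->
  (forall j, (j < k.+1)%N -> 0 < iln j t) ->
  vis_derive (fun s => ZA_sum A S xi (Lhat k s)) t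
    (- (A *m ZA_sum A S xi (Lhat k t)) + power_sum S xi (Lhat k t)
     + ZA_residual t).
Proof.
move=> hA S0 lt0; set eta := fun a : 'rV[C]_k.+2 => invmx (A + (a ord0 ord0)%:M) *m xi a.
have -> : - (A *m ZA_sum A S xi (Lhat k t)) + power_sum S xi (Lhat k t)
    + ZA_residual t = \sum_(a <- S) (mpow (Lhat k t) a *
      \sum_(i < k.+2) a ord0 i * (diln i t)%:C%C) *: eta a.
  rewrite /ZA_sum /power_sum /ZA_residual mulmx_sumr -sumrN -!big_split /=.
  rewrite !big_seq; apply: eq_bigr => a aS.
  have xiE : xi a = A *m eta a + a ord0 ord0 *: eta a.
    rewrite -mul_scalar_mx -mulmxDl /eta mulKVmx //.
    exact: unitmx_addM hA (S0 a aS).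
  rewrite -/(eta a) xiE -scalemxAr scalerDr addKr scalerA -scalerDl -mulrDr.
  by rewrite [in RHS]big_ord_recl mulr1.
apply/vis_derive_cderive => i; rewrite summxE; under eq_fun do rewrite summxE.
apply: cderive_sum => a _; rewrite mxE mulrC.
under eq_fun do rewrite mxE mulrC.
exact/cderiveMl/cderive_mpow_Lhat.
Qed.

Lemma ZA_residual_bigO m mu nu : (m <= k)%N -> nu < mu + 1 ->
  (forall a, a \in S -> Eset m%:Z (- mu) a) ->
  forall i, cbigO (fun t => expR (- nu * iln m.+1 t))
    (fun t => ZA_residual t i ord0).
Proof.
move=> mk numu hS i; under [X in cbigO _ X]eq_fun do rewrite summxE.
apply: cbigO_sum_seq => a aS; under [X in cbigO _ X]eq_fun do rewrite mxE mulrC mulr_sumr.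
apply/cbigOMl/cbigO_sum => j _.
under [X in cbigO _ X]eq_fun do rewrite mulrCA.
apply: cbigOMl; exists 1.
(* The monomial is O(L_m^(-mu + e)) and the derivative factor O(L_m^(-1)); e = mu + 1 - nu makes the
   product O(L_m^(-nu)). *)
have e0 : 0 < mu + 1 - nu by lra.
near=> t; rewrite mul1r normcM normc_real.
have ae : normc (mpow (Lhat k t) a)
    <= expR (- (mu - (mu + 1 - nu)) * iln m.+1 t).
  by near: t; apply: normc_mpow_Lhat_le => //; exact: hS.
have dj : `|diln j.+1 t| <= expR (- iln m.+1 t).
  apply: (@le_trans _ _ t^-1); near: t; first exact: diln_le.
  exact: inv_le_expR_iln.
apply: (le_trans (ler_pM (normc_ge0 _) (normr_ge0 _) ae dj)).
by rewrite -expRD ler_expR le_eqVlt; apply/orP; left; apply/eqP; ring.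
Unshelve. all: end_near. Qed.

End ApproximateSolution.

Lemma normc_le_enorm n (v : 'cV[C]_n) i : normc (v i ord0) <= enorm v.
Proof.
rewrite -ler_sqr ?nnegrE ?normc_ge0 ?sqrtr_ge0 // sqr_normcE.
rewrite sqr_sqrtr; last by apply: sumr_ge0 => j _; rewrite addr_ge0 ?sqr_ge0.
by rewrite (bigD1 i) //= lerDl sumr_ge0 // => j _; rewrite addr_ge0 ?sqr_ge0.
Qed.

Lemma enorm_le_sum n (v : 'cV[C]_n) : enorm v <= \sum_i normc (v i ord0).
Proof.
have s0 : 0 <= \sum_i normc (v i ord0) by apply: sumr_ge0 => *; exact: normc_ge0.
rewrite -ler_sqr ?nnegrE ?sqrtr_ge0 //.
rewrite sqr_sqrtr; last by apply: sumr_ge0 => j _; rewrite addr_ge0 ?sqr_ge0.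
under eq_bigr do rewrite -sqr_normcE.
rewrite expr2 mulr_suml; apply: ler_sum => i _.
rewrite expr2 ler_wpM2l ?normc_ge0 // (bigD1 i) //= lerDl.
by apply: sumr_ge0 => *; exact: normc_ge0.
Qed.

(** Two comparison functions are used because the exponential form and the power form of L_m^(-nu)
    need agree only for large t. *)
Lemma isO_enorm n (w : R -> 'cV[C]_n) (h1 h2 : R -> R) :
  (\forall t \near +oo, 0 <= h1 t /\ h1 t = h2 t) ->
  (forall i, cbigO h1 (fun t => w t i ord0)) -> isO (fun t => enorm (w t)) h2.
Proof.
move=> hh wO.
have [K KP] : exists K, \forall t \near +oo,
    \sum_i normc (w t i ord0) <= K * h1 t.
  elim: (index_enum _) => [|i r [K KP]].
    by exists 0; near=> t; rewrite big_nil mul0r.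
  have [L LP] := wO i; exists (L + K); near=> t.
  by rewrite big_cons mulrDl lerD //; near: t.
have [T [_ TP]] := filterI hh KP.
exists (`|T| + 1), (`|K| + 1); split; [by rewrite ltr_wpDl..|move=> t Tt].
have [|[h0 hE] Kt] := TP t.
  by rewrite (lt_le_trans _ Tt) // (le_lt_trans (ler_norm _)) // ltrDl.
rewrite ger0_norm ?sqrtr_ge0 // (le_trans (enorm_le_sum _)) // -hE.
by rewrite (le_trans Kt) // ler_wpM2r // (le_trans (ler_norm _)) // lerDl.
Unshelve. all: end_near. Qed.

End PowerSums.

(** * Comparison of the solution with the approximate solution *)

Theorem theorem5p5 (R : realType) (n : nat) (hn : (0 < n)%N) (A : 'M[R[i]]_n)
    (hA : forall l : R[i], eigenvalue A l -> 0 < complex.Re l)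
    (m k : nat) (hmk : (m <= k)%N)
    (t0 : R) (ht0 : Eiter k 0 < t0)
    (mu : R) (hmu : 0 < mu)
    (p : 'rV[R]_k.+2 -> 'cV[R[i]]_n) (hp : Pclass m%:Z (- mu) p)
    (g : R -> 'cV[R[i]]_n) (hgc : vcontinuous_on `[t0, +oo[ g)
    (hg : exists2 alpha : R, mu < alpha &
       isO (fun t : R => enorm (g t)) (fun t : R => Liter m%:Z t `^ (- alpha)))
    (y : R -> 'cV[R[i]]_n) (hyc : vcontinuous_on `[t0, +oo[ y)
    (hy : forall t : R, t0 < t ->
       vis_derive y t (- (A *m y t) + p (Lhat k t) + g t)) :
  exists2 delta : R, 0 < delta &
    isO (fun t : R => enorm (y t - ZA A p (Lhat k t)))
        (fun t : R => Liter m%:Z t `^ (- mu - delta)).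
Proof.
have [S [xi [hS hSp]]] := hp.
have [alpha hal [Tg [Kg [_ Kg0 gP]]]] := hg.
(* Position 0 has index -1, which is below m. *)
have S0 a : a \in S -> complex.Re (a ord0 ord0) = 0.
  by move=> /hS [+ _]; apply; rewrite /cidx sub0r.
rewrite (ZAE A S0 hSp).
(* The bound 1/2 keeps delta < 1, as the residual requires; delta <= alpha - mu makes g of size
   O(L_m^(-mu - delta)). *)
pose delta := Num.min (2^-1) (alpha - mu).
have d0 : 0 < delta by rewrite lt_min invr_gt0 ltr0n subr_gt0 hal.
have d1 : mu + delta < mu + 1.
  have : delta <= 2^-1 by rewrite ge_min lexx.
  by lra.
have da : mu + delta <= alpha.
  have : delta <= alpha - mu by rewrite ge_min lexx orbT.
  by lra.
exists delta => //.
pose h (t : R) := expR (- (mu + delta) * iln m.+1 t).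
apply: (@isO_enorm _ _ _ h).
  near=> t; split; first exact: expR_ge0.
  rewrite -opprD powR_iln //; near: t; exact: iln_gt0.
(* The difference of [y] and the approximate solution has forcing g minus the residual, as the terms
   in p cancel. *)
apply: (@cbigO_linear_ode _ _ A _ (fun t => g t - ZA_residual A S xi t)) => //.
- exact: slow_exp_iln.
- near=> t.
  have yt : vis_derive y t (- (A *m y t) + p (Lhat k t) + g t).
    by apply: hy; near: t; apply: nbhs_pinfty_gt; exact: num_real.
  have := @vis_derive_ZA_sum _ _ _ _ S xi t hA S0.
  have lt0 : forall j, (j < k.+1)%N -> 0 < iln j t by near: t; exact: iln_gt0_upto.
  move=> /(_ lt0) qt.
  rewrite -hSp in qt; last by near: t; exact: posorthant_Lhat.
  apply/vis_derive_cderive => i.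
  have yi := yt i; have qi := cderiveMl (-1) (qt i).
  have := cderiveD yi qi.
  under eq_fun do rewrite mulN1r.
  rewrite (_ : (fun s => (y s - _) i ord0) =
    (fun s => y s i ord0 - ZA_sum A S xi (Lhat k s) i ord0)); last first.
    by apply/funext => s; rewrite !mxE.
  congr cderive.
  by rewrite mulmxBr opprB !mxE; ring.
- move=> i; under [X in cbigO _ X]eq_fun do rewrite mxE [(- ZA_residual _ _ _ _) _ _]mxE.
  apply: cbigOD; last by apply/cbigON/(@ZA_residual_bigO _ _ _ _ _ _ m mu).
  exists Kg; near=> t.
  apply: (le_trans (normc_le_enorm _ _)); apply: (le_trans (ler_norm _)).
  apply: (le_trans (gP t _)) => //.
  rewrite ler_pM2l // (powR_iln _ (m := m)); last by near: t; exact: iln_gt0.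
  rewrite ler_expR ler_wpM2r ?lerN2 //.
  by apply: ltW; near: t; exact: iln_gt0.
Unshelve. all: end_near. Qed.
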